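(* Let $p$ be a prime, $r,n\ge1$ integers, let $\mathcal{C}\subseteq\mathbb{F}_{p^r}^n$ be a linear code and let $\mathcal{C}^\perp$ denote its dual. For a given $\rho\in\mathbb{D}^\lambda_n$, the number of codewords in $\mathcal{C}^\perp$ of subfield-trace decomposition $\rho$ is given by $$\mathcal{D}^\lambda_\rho(\mathcal{C}^\perp)=\frac1{|\mathcal{C}|}\sum_{\pi\in\mathbb{D}^\lambda_n}K^\lambda_\pi(\rho)\,\mathcal{D}^\lambda_\pi(\mathcal{C}).$$ Here $K^\lambda_\pi(\rho)$ denotes the value of the Krawtchouk coefficient of $\rho$ with respect to $\pi$ which, for a given $p$-th root of unity $\xi$, is $$K^\lambda_\pi(\rho)=\sum_{t\in\mathrm{Comp}^\lambda_\pi(\rho)}\left(\prod_{i=0}^3\binom{\pi_i}{t_{i0},\dots,t_{i3}}\right)\cdot\kappa^\lambda,$$ where $\kappa^\lambda$ takes the value $$(p-1)^{t_{01}+t_{11}+t_{21}+t_{03}}(-1)^{t_{31}}(-p)^{t_{22}}(p^{r-1}-p)^{t_{02}+t_{12}}(-p^{r-1})^{t_{13}}(p^{r-1})^{t_{03}}$$ if $r\mid p$, and $$(p-1)^{t_{01}+t_{03}}(-1)^{t_{11}+t_{22}+t_{33}+t_{32}}(1-p)^{t_{23}}(p^{r-1}-1)^{t_{02}+t_{03}+t_{12}+t_{21}}(1-p^{r-1})^{t_{13}}$$ if $r\nmid p$.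
   Context: A linear code is an $\mathbb{F}_{p^r}$-subspace $\mathcal{C}\subseteq\mathbb{F}_{p^r}^n$; its dual is $\mathcal{C}^\perp=\{x:\sum_ix_ic_i=0\ \text{for all } c\in\mathcal{C}\}$. Let $\operatorname{Tr}:\mathbb{F}_{p^r}\to\mathbb{F}_p$ be the trace. The subfield-trace partition of $\mathbb{F}_{p^r}$ is given by $I_0=\{0\}$, $I_1=\mathbb{F}_p^\times$, $I_2=\{x\in\mathbb{F}_{p^r}\setminus\mathbb{F}_p:\operatorname{Tr}(x)=0\}$, $I_3=\{x\in\mathbb{F}_{p^r}\setminus\mathbb{F}_p:\operatorname{Tr}(x)\neq0\}$. For $x\in\mathbb{F}_{p^r}^n$ its subfield-trace decomposition is $\pi(x)=(\pi_0,\pi_1,\pi_2,\pi_3)$ with $\pi_i=|\{k:x_k\in I_i\}|$. $\mathbb{D}^\lambda_n$ is the set of all decompositions of elements of $\mathbb{F}_{p^r}^n$, and $\mathcal{D}^\lambda_\pi(\mathcal{C})=|\{c\in\mathcal{C}:\pi(c)=\pi\}|$. For $\pi,\rho\in\mathbb{D}^\lambda_n$, $\mathrm{Comp}^\lambda_\pi(\rho)$ is the set of arrays $t=(t_{ij})_{0\le i,j\le3}$ of nonnegative integers with $\sum_jt_{ij}=\pi_i$ for all $i$ and $\sum_it_{ij}=\rho_j$ for all $j$. $\binom{\pi_i}{t_{i0},\dots,t_{i3}}=\frac{\pi_i!}{t_{i0}!\cdots t_{i3}!}$ is the multinomial coefficient, and powers with exponent $0$ equal $1$. The Krawtchouk coefficient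 of $\rho$ with respect to $\pi$ is the sum $\sum_x\chi_a(x)$ over all $x\in\mathbb{F}_{p^r}^n$ of subfield-trace decomposition $\rho$, where $a$ is any element of decomposition $\pi$ and $\chi_a(x)=\xi^{\operatorname{Tr}(\sum_k a_kx_k)}$.
   Formalization: κ is corrected: the cases are p∣r and p∤r, not r∣p and r∤p; the first case gains the factor 0^(t23+t32+t33); in the second, t21 moves from base p^(r-1)−1 to p−1 and −1 has exponent t11+t22+t31+t32. ξ is a primitive p-th root of unity. *)

(* Defs.v *)
From HB Require Import structures.
From mathcomp Require Import all_boot all_order all_algebra all_fingroup.
From mathcomp Require Import all_solvable all_field.

Set Implicit Arguments.
Unset Strict Implicit.
Unset Printing Implicit Defensive.

Import Order.TTheory GRing.Theory Num.Theory.
Local Open Scope ring_scope.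

(* Throughout, F is a field with p ^ r elements, and 'F_p is identified with  *)
(* the prime subfield of F.                                                   *)

Definition prime_subfield (p : nat) (F : finFieldType) : {set F} :=
  [set k%:R | k : 'I_p].

(* The trace from F to 'F_p as the sum of the conjugates of x; it agrees with *)
(* galTrace, see fp_traceE below. Its value is an element of F lying in the   *)
(* prime subfield.                                                            *)
Definition fp_trace (p r : nat) (F : finFieldType) (x : F) : F :=
  \sum_(i < r) x ^+ (p ^ i).

(* The k < p such that k%:R = y, for y in the prime subfield. *)
Definition fp_val (p : nat) (F : finFieldType) (y : F) : nat :=
  index y [seq (k%:R : F) | k <- iota 0 p].

Definition st_block (p r : nat) (F : finFieldType) (i : 'I_4) : {set F} :=
  match val i with
  | 0 => [set 0]
  | 1 => prime_subfield p F :\ 0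
  | 2 => [set x | (x \notin prime_subfield p F) && (fp_trace p r x == 0)]
  | _ => [set x | (x \notin prime_subfield p F) && (fp_trace p r x != 0)]
  end.

Lemma st_count_subproof (n : nat) (A : {set 'I_n}) : (#|A| < n.+1)%N.
Proof. by rewrite ltnS -[leqRHS]card_ord max_card. Qed.

(* The counts are at most n, hence the values in 'I_n.+1. *)
Definition st_dec (p r : nat) (F : finFieldType) (n : nat) (x : 'rV[F]_n) :
    {ffun 'I_4 -> 'I_n.+1} :=
  [ffun i => Ordinal (st_count_subproof
                        [set k : 'I_n | x ord0 k \in st_block p r F i])].

Definition st_decs (p r : nat) (F : finFieldType) (n : nat) :
    {set {ffun 'I_4 -> 'I_n.+1}} :=
  [set st_dec p r x | x : 'rV[F]_n].

Definition st_enum (p r : nat) (F : finFieldType) (n : nat)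
    (A : {pred 'rV[F]_n}) (pi : {ffun 'I_4 -> 'I_n.+1}) : nat :=
  #|[set c in A | st_dec p r c == pi]|.

Definition dual_code (F : finFieldType) (n : nat) (C : {vspace 'rV[F]_n}) :
    {set 'rV[F]_n} :=
  [set x : 'rV[F]_n
     | [forall (c : 'rV[F]_n | c \in C), \sum_i x 0 i * c 0 i == 0]].

(* The entries of such an array are bounded by the pi i <= n, so nothing is   *)
(* lost by taking them in 'I_n.+1.                                            *)
Definition st_comp (n : nat) (pi rho : {ffun 'I_4 -> 'I_n.+1}) :
    {set 'M['I_n.+1]_4} :=
  [set t : 'M['I_n.+1]_4
     | [forall i, (\sum_j (t i j : nat) == pi i)%N]
       && [forall j, (\sum_i (t i j : nat) == rho j)%N]].

(* The division is exact when the t_j sum to m. *)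
Definition multinomial (m : nat) (t : 'I_4 -> nat) : nat :=
  (m`! %/ \prod_j (t j)`!)%N.

Definition entry (n : nat) (t : 'M['I_n.+1]_4) (i j : nat) : nat :=
  t (inord i) (inord j).

(* For t = (t_ij), kappa is the product over i and j of s_ij ^+ t_ij, where   *)
(* s_ij is the sum over x in block j of xi ^ Tr(a x), for any a in block i:   *)
(*   p %| r:   j = 0   1      2           3                                   *)
(*     i = 0       1   p-1    p^(r-1)-p   (p-1)p^(r-1)                        *)
(*     i = 1       1   p-1    p^(r-1)-p   -p^(r-1)                            *)
(*     i = 2       1   p-1    -p          0                                   *)
(*     i = 3       1   -1     0           0                                   *)
(*   else:     j = 0   1      2           3                                   *)
(*     i = 0       1   p-1    p^(r-1)-1   (p-1)(p^(r-1)-1)                    *)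
(*     i = 1       1   -1     p^(r-1)-1   1-p^(r-1)                           *)
(*     i = 2       1   p-1    -1          1-p                                 *)
(*     i = 3       1   -1     -1          1                                   *)
(* The published formula differs from this table and does not give these      *)
(* character sums: its case condition reads r %| p; its first case has no     *)
(* factor 0 ^ (t_23 + t_32 + t_33); in its second case the bases of t_21,     *)
(* t_31 and t_33 are p^(r-1)-1, 1 and -1.                                     *)
Definition st_kappa (p r n : nat) (t : 'M['I_n.+1]_4) : int :=
  let P : int := p%:Z in
  let Q : int := p%:Z ^+ r.-1 in
  if (p %| r)%N then
    (P - 1) ^+ (entry t 0 1 + entry t 1 1 + entry t 2 1 + entry t 0 3)
    * (-1) ^+ entry t 3 1
    * (- P) ^+ entry t 2 2
    * (Q - P) ^+ (entry t 0 2 + entry t 1 2)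
    * (- Q) ^+ entry t 1 3
    * Q ^+ entry t 0 3
    * 0 ^+ (entry t 2 3 + entry t 3 2 + entry t 3 3)
  else
    (P - 1) ^+ (entry t 0 1 + entry t 0 3 + entry t 2 1)
    * (-1) ^+ (entry t 1 1 + entry t 2 2 + entry t 3 1 + entry t 3 2)
    * (1 - P) ^+ entry t 2 3
    * (Q - 1) ^+ (entry t 0 2 + entry t 0 3 + entry t 1 2)
    * (1 - Q) ^+ entry t 1 3.

Definition st_kraw (p r n : nat) (pi rho : {ffun 'I_4 -> 'I_n.+1}) : int :=
  \sum_(t in st_comp pi rho)
    (\prod_i multinomial (pi i) (fun j => t i j))%N%:Z * st_kappa p r t.

Definition st_char (p r : nat) (F : finFieldType) (n : nat)
    (L : numClosedFieldType) (xi : L) (a x : 'rV[F]_n) : L :=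
  xi ^+ fp_val p (fp_trace p r (\sum_k a 0 k * x 0 k)).

Lemma fp_traceE (p r : nat) (F : finFieldType) (pcharF : p \in [pchar F])
    (x : F) :
  #|F| = (p ^ r)%N ->
  fp_trace p r x
    = galTrace 1%AS {: pPrimeCharType pcharF} (x : pPrimeCharType pcharF).
Proof.
move=> cardF.
have p_pr : prime p by case/andP: pcharF.
pose R := pPrimeCharType pcharF.
have [/= alpha gen_alpha alphaE] :=
  @finField_galois_generator 'F_p R 1%AS {:R}%AS (sub1v _).
rewrite card_Fp // dimv1 expn1 in alphaE.
have gal1 : galois 1 {:R} := @finField_galois 'F_p R 1%AS {:R}%AS (sub1v _).
have dimR : \dim {:R} = r.
  by rewrite (pprimeChar_dimf pcharF) cardF pfactorK.
have ord_alpha : #[alpha]%g = r.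
  rewrite orderE -(eqP gen_alpha) -(galois_dim gal1) dimv1 divn1.
  exact: dimR.
have alphaXE k (y : R) : (alpha ^+ k)%g y = y ^+ (p ^ k).
  elim: k => [|k IHk]; first by rewrite expg0 gal_id.
  by rewrite expgSr galM ?memvf // alphaE ?memvf // IHk -exprM -expnSr.
rewrite /galTrace (eqP gen_alpha).
have -> : <[alpha]>%g = [set (alpha ^+ val i)%g | i : 'I_r].
  apply/setP=> y; apply/idP/imsetP => [/cyclePmin[i lt_i ->]|[i _ ->]].
    by rewrite ord_alpha in lt_i; exists (Ordinal lt_i).
  exact: mem_cycle.
rewrite big_imset => [|i j _ _ /eqP]; last first.
  rewrite eq_expg_mod_order ord_alpha !(modn_small (ltn_ord _)).
  by move=> /eqP/val_inj.
by apply: eq_bigr => i _; rewrite alphaXE.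
Qed.

(* Main.v *)
Require Import Defs.
From HB Require Import structures.
From mathcomp Require Import all_boot all_order all_algebra all_fingroup.
From mathcomp Require Import all_solvable all_field.
From mathcomp Require Import ring.
Set Implicit Arguments.
Unset Strict Implicit.
Unset Printing Implicit Defensive.
Import Order.TTheory GRing.Theory Num.Theory.
Local Open Scope ring_scope.

(** Write e x = xi ^ Tr x, an additive character of F with values in the roots
    of unity of L, so that st_char sends (a, x) to the product over k of
    e (a_k x_k). Everything rests on two facts.

    First, for a in block i the sum of e (a x) over block j depends on i and j
    only (sum_trace_char_block). A sum of e (a x) over an additive subgroup H
    is #|H| or 0, according as the character is trivial on H or not. On the
    prime subfield it is trivial iff Tr a = 0, on F iff a = 0, and on the kernel
    of the trace iff a lies in the prime subfield. The blocks are differences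
    of these subgroups, and the prime subfield is inside the kernel of the
    trace when p divides r, and meets it in 0 otherwise: hence the two cases.

    Second, distributing a product over a sum, the sum of e (a_1 x_1 + ...) over
    the vectors x whose coordinates lie in prescribed blocks f 1, ..., f n is
    the product of the block sums s (b k, f k), where b k is the block of a_k
    (sum_st_char_pattern). This product depends only on the numbers t_ij of
    indices k with b k = i and f k = j; it is st_kappa t (prod_block_char_sum).
    For given b, the number of maps f having the table t is the product of the
    multinomial coefficients of its rows (card_colourings). Adding up over all
    f with fibres of sizes rho gives the Krawtchouk coefficient
    (sum_st_char_dec).

    The identity for the dual code is then double counting of the sum of
    chi_c(x) over c in C and x of decomposition rho. Summed over c first, it
    counts each x of the dual code with weight #|C| and any other x with weight
    0 (sum_code_st_char); summed over x first, it gives K_pi(rho) for each c of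
    decomposition pi. *)

(** * Counting maps with a given contingency table *)

Section Counting.

Definition fibre_card {T K : finType} (g : T -> K) (x : K) : nat :=
  #|[set k | g k == x]|.

Lemma fibre_card_recl (K : finType) (m : nat) (g : 'I_m.+1 -> K) (x : K) :
  fibre_card g x
    = ((g ord0 == x) + fibre_card (fun k => g (lift ord0 k)) x)%N.
Proof.
rewrite /fibre_card -!sum1dep_card big_mkcond big_ord_recl /=.
rewrite [in RHS]big_mkcond /=.
by case: (g ord0 == x).
Qed.

Lemma prod_expr_fibre (R : comPzSemiRingType) (T K : finType) (g : T -> K)
    (s : K -> R) :
  \prod_k s (g k) = \prod_x s x ^+ fibre_card g x.
Proof.
rewrite (partition_big g predT) //=; apply: eq_bigr => x _.
rewrite -prodr_const; apply: eq_big => k; first by rewrite inE.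
by move=> /eqP->.
Qed.

Lemma fact_prod_sub1 (K : finType) (t : K -> nat) (x0 : K) :
  (0 < t x0)%N ->
  (\prod_x (t x)`! = t x0 * \prod_x (t x - (x0 == x))`!)%N.
Proof.
move=> t_gt0; rewrite (bigD1 x0) //= [in RHS](bigD1 x0) //= eqxx mulnA.
congr (_ * _)%N; first by case: (t x0) t_gt0 => // u _; rewrite subn1 factS.
by apply: eq_bigr => x /negPf ne; rewrite eq_sym ne subn0.
Qed.

(** Given b, this counts the maps f for which (b, f) takes each value x exactly
    t x times. Fix f at the index 0, say f 0 = j: what remains is the same
    problem on m indices with t (b 0, j) decreased by 1, so that this choice of
    j contributes t (b 0, j) times the product of the remaining factorials.
    Summing over j gives the row sum, which is the factor that the factorial of
    the fibre of b 0 needs. *)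
Lemma card_colourings (m : nat) (I J : finType) (b : 'I_m -> I)
    (t : I * J -> nat) :
  (forall i, (\sum_j t (i, j) = fibre_card b i)%N) ->
  (#|[set f : {ffun 'I_m -> J}
       | [forall x, fibre_card (fun k => (b k, f k)) x == t x]]|
     * \prod_x (t x)`! = \prod_i (fibre_card b i)`!)%N.
Proof.
elim: m b t => [|m IHm] b t row_t.
  have fib0 (K : finType) (g : 'I_0 -> K) x : fibre_card g x = 0%N.
    by apply: eq_card0 => -[].
  have t0 x : t x = 0%N.
    case: x => i j; apply/eqP; rewrite -leqn0 -(fib0 _ b i) -row_t.
    by rewrite (bigD1 j) ?leq_addr.
  rewrite !big1 => [|i _|x _]; rewrite ?fib0 ?t0 // muln1.
  rewrite (_ : [set _ | _] = setT) ?cardsT ?card_ffun ?card_ord //.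
  by apply/setP => f; rewrite !inE; apply/forallP => x; rewrite fib0 t0.
pose b' k := b (lift ord0 k).
pose ext (u : J * {ffun 'I_m -> J}) : {ffun 'I_m.+1 -> J} :=
  [ffun k => oapp u.2 u.1 (unlift ord0 k)].
pose res (f : {ffun 'I_m.+1 -> J}) : J * {ffun 'I_m -> J} :=
  (f ord0, [ffun k => f (lift ord0 k)]).
have extK : cancel ext res.
  case=> j f; congr (_, _); first by rewrite ffunE unlift_none.
  by apply/ffunP => k; rewrite !ffunE liftK.
have resK : cancel res ext.
  move=> f; apply/ffunP => k; rewrite !ffunE.
  by case: unliftP => [l|] -> /=; rewrite ?ffunE.
rewrite -sum1dep_card (reindex ext); last by exists res => ? _.
rewrite -(pair_big_dep predT
  (fun j f => [forall x, fibre_card (fun k => (b k, ext (j, f) k)) x == t x])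
  (fun _ _ => 1%N)) /= big_distrl /=.
have term j : ((\sum_(f | [forall x,
      fibre_card (fun k => (b k, ext (j, f) k)) x == t x]) 1) * \prod_x (t x)`!
    = t (b ord0, j) * \prod_i (fibre_card b' i)`!)%N.
  have fibE f x : fibre_card (fun k => (b k, ext (j, f) k)) x
      = ((((b ord0, j) : I * J) == x) + fibre_card (fun k => (b' k, f k)) x)%N.
    rewrite fibre_card_recl ffunE unlift_none /=; congr (_ + _)%N.
    by apply: eq_card => k; rewrite !inE ffunE liftK.
  have [t0|t_gt0] := posnP (t (b ord0, j)).
    rewrite t0 mul0n big1 // => f /forallP/(_ (b ord0, j)).
    by rewrite fibE eqxx t0.
  rewrite (fact_prod_sub1 t_gt0) mulnCA -(IHm b' (fun x => t x
    - (((b ord0, j) : I * J) == x))%N).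
    rewrite sum1dep_card; congr (_ * (_ * _))%N; apply: eq_card => f.
    rewrite !inE; apply: eq_forallb => x; rewrite fibE.
    have [<-|_] := eqVneq ((b ord0, j) : I * J) x; last by rewrite subn0.
    by rewrite -[in RHS](eqn_add2l 1) subnKC.
  move=> i; apply/eqP; rewrite -(eqn_add2l (b ord0 == i)) -fibre_card_recl.
  rewrite -row_t; have [<-|ne] := eqVneq (b ord0) i.
    rewrite (bigD1 j) //= [in eqbRHS](bigD1 j) //= eqxx addnA subnKC //.
    rewrite eqn_add2l; apply/eqP/eq_bigr => l /negPf nl.
    by rewrite xpair_eqE eqxx eq_sym nl subn0.
  by apply/eqP/eq_bigr => l _; rewrite xpair_eqE (negPf ne) subn0.
under eq_bigr do rewrite term.
rewrite -big_distrl row_t /= [in RHS](@fact_prod_sub1 _ _ (b ord0)).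
  by congr (_ * _)%N; apply: eq_bigr => i _; rewrite fibre_card_recl addKn.
by rewrite fibre_card_recl eqxx.
Qed.

(** The quotient is an integer because it counts the maps from m points to 'I_4
    with t j points above j: this is the case of a one-element I. *)
Lemma multinomial_fact (m : nat) (t : 'I_4 -> nat) :
  (\sum_j t j = m)%N -> (multinomial m t * \prod_j (t j)`! = m`!)%N.
Proof.
move=> sum_t; rewrite /multinomial divnK //.
have := @card_colourings m unit 'I_4 (fun=> tt) (fun x => t x.2).
have -> : (\prod_(x : unit * 'I_4) (t x.2)`! = \prod_j (t j)`!)%N.
  by rewrite (reindex (fun j => (tt, j))) //; exists snd => [|[[] ?]].
rewrite (bigD1 tt) //= big_pred0_eq muln1.
have fib_m : fibre_card (fun _ : 'I_m => tt) tt = m.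
  by rewrite -[RHS]card_ord; apply: eq_card => k; rewrite !inE.
rewrite fib_m => <-; first exact: dvdn_mull.
by case; rewrite fib_m.
Qed.

End Counting.

(** * Character sums over the blocks *)

Section CharacterSums.

(** Translating H by v permutes it and multiplies the sum by chi v. *)
Lemma sum_nontrivial_eq0 (V : finZmodType) (R : idomainType) (H : {pred V})
    (chi : V -> R) (v : V) :
  {morph chi : x y / x + y >-> x * y} ->
  (forall x, (v + x \in H) = (x \in H)) -> chi v != 1 ->
  \sum_(x in H) chi x = 0.
Proof.
move=> chiD vH chi_v; set S := LHS.
have eqS : S = chi v * S.
  rewrite {1}/S (reindex_inj (addrI v)) mulr_sumr.
  by apply: eq_big => x; rewrite ?vH // chiD.
have /eqP : (1 - chi v) * S = 0 by rewrite mulrBl mul1r -eqS subrr.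
by rewrite mulf_eq0 subr_eq0 eq_sym (negPf chi_v) => /eqP.
Qed.

Variables (p r : nat) (F : finFieldType).
Hypotheses (p_prime : prime p) (cardF : #|F| = (p ^ r)%N).

Let pcharF : p \in [pchar F] := card_finPcharP cardF p_prime.
Let Fp := prime_subfield p F.
Let T := @fp_trace p r F.
Let p_gt0 : (0 < p)%N := prime_gt0 p_prime.

Lemma mem_prime_subfield (k : nat) : k%:R \in Fp.
Proof.
rewrite -(GRing.natr_mod_pchar pcharF); apply/imsetP.
by exists (Ordinal (ltn_pmod k p_gt0)).
Qed.

Lemma prime_subfieldP (x : F) :
  reflect (exists2 k, (k < p)%N & x = k%:R) (x \in Fp).
Proof.
apply: (iffP imsetP) => [[k _ ->]|[k _ ->]]; first by exists k.
by apply/imsetP; apply: mem_prime_subfield.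
Qed.

Lemma eqr_nat_pchar (k l : nat) :
  (k%:R == l%:R :> F) = (k == l %[mod p])%N.
Proof.
wlog le_lk : k l / (l <= k)%N.
  move=> IH; case/orP: (leq_total k l) => /IH // eq_lk.
  by rewrite eq_sym eq_lk eq_sym.
by rewrite eqn_mod_dvd // (dvdn_pcharf pcharF) natrB // subr_eq0.
Qed.

Lemma prime_subfieldD (x y : F) : x \in Fp -> (x + y \in Fp) = (y \in Fp).
Proof.
have Fp_add u v : u \in Fp -> v \in Fp -> u + v \in Fp.
  case/prime_subfieldP=> k _ -> /prime_subfieldP[l _ ->].
  by rewrite -natrD mem_prime_subfield.
move=> Fpx; apply/idP/idP => [Fpxy|]; last exact: Fp_add.
(* In characteristic p, p.-1 times x is the opposite of x. *)
have -> : y = x *+ p.-1 + (x + y).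
  by rewrite addrA -mulrSr prednK // mulrn_pchar // add0r.
apply: Fp_add => //; case/prime_subfieldP: Fpx => k _ ->.
by rewrite -mulrnA mem_prime_subfield.
Qed.

Lemma prime_subfield0 : 0 \in Fp.
Proof. exact: (mem_prime_subfield 0). Qed.

Lemma card_prime_subfield : #|Fp| = p.
Proof.
rewrite card_imset ?card_ord // => k l /eqP.
by rewrite eqr_nat_pchar !modn_small // => /eqP/val_inj.
Qed.

Lemma fp_val_lt (x : F) : x \in Fp -> (fp_val p x < p)%N.
Proof.
case/prime_subfieldP=> k lt_kp ->.
rewrite /fp_val -[ltnRHS](size_iota 0) -(size_map (fun k => k%:R : F)).
by rewrite index_mem map_f // mem_iota.
Qed.

Lemma fp_valK (x : F) : x \in Fp -> (fp_val p x)%:R = x.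
Proof.
move=> Fpx; have lt_p := fp_val_lt Fpx.
have Fx : x \in [seq (k%:R : F) | k <- iota 0 p].
  by rewrite -index_mem size_map size_iota.
have := nth_index 0 Fx.
by rewrite (nth_map 0%N) ?size_iota // nth_iota.
Qed.

(** The identification with the Galois trace makes it additive. *)
Lemma fp_traceB (x y : F) : T (x - y) = T x - T y.
Proof.
rewrite /T !(fp_traceE pcharF _ cardF).
exact: (raddfB (galTrace 1%AS {: pPrimeCharType pcharF})).
Qed.

Lemma fp_trace0 : T 0 = 0.
Proof. by have := fp_traceB 0 0; rewrite !subrr. Qed.

Lemma fp_traceD (x y : F) : T (x + y) = T x + T y.
Proof.
have -> : x + y = x - (0 - y) by rewrite sub0r opprK.
by rewrite !fp_traceB fp_trace0 sub0r opprK.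
Qed.

Lemma fp_trace_natr (k : nat) (x : F) : T (k%:R * x) = k%:R * T x.
Proof.
elim: k => [|k IHk]; first by rewrite !mul0r fp_trace0.
by rewrite mulrS !mulrDl !mul1r fp_traceD IHk.
Qed.

Let galF : galois 1 {: pPrimeCharType pcharF} :=
  @finField_galois 'F_p (pPrimeCharType pcharF) 1%AS _ (sub1v _).

(** The Galois trace is Galois invariant, and thus in the base field. *)
Lemma fp_trace_mem (x : F) : T x \in Fp.
Proof.
rewrite /T (fp_traceE pcharF _ cardF).
have /vlineP[k ->] := mem_galTrace galF (memvf (x : pPrimeCharType pcharF)).
by rewrite -[_ *: _]/(k%:R * 1 : F) mulr1 mem_prime_subfield.
Qed.

(** Otherwise the sum of the automorphisms of F would vanish, against their
    linear independence. *)
Lemma fp_trace_neq0 : exists x, T x != 0.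
Proof.
have [x _] := @gal_independent_contra _ _ {: pPrimeCharType pcharF}
  [in 'Gal({: pPrimeCharType pcharF} / 1)%g] (fun=> 1) 1%g
  (group1 _) (oner_neq0 _).
under eq_bigr do rewrite mul1r.
by exists x; rewrite /T (fp_traceE pcharF _ cardF).
Qed.

Lemma fp_trace_subfield (x : F) : x \in Fp -> T x = r%:R * x.
Proof.
case/prime_subfieldP=> k _ ->; rewrite -[k%:R]mulr1 fp_trace_natr mulrCA.
congr (_ * _); rewrite /T /fp_trace.
by under eq_bigr do rewrite expr1n; rewrite sumr_const card_ord mulr1.
Qed.

Variables (L : numClosedFieldType) (xi : L).
Hypothesis xi_prim : p.-primitive_root xi.

Definition trace_char (x : F) : L := xi ^+ fp_val p (T x).
Local Notation e := trace_char.

(** As xi has order p, any integer representing the trace will do as exponent;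
    this is how the choice made by fp_val is forgotten. *)
Lemma trace_charE (k : nat) (x : F) : T x = k%:R -> e x = xi ^+ k.
Proof.
move=> Tx; apply/eqP; rewrite (eq_prim_root_expr xi_prim) -eqr_nat_pchar.
by rewrite fp_valK ?fp_trace_mem // Tx.
Qed.

Lemma trace_charD : {morph e : x y / x + y >-> x * y}.
Proof.
move=> x y; rewrite -exprD; apply: trace_charE.
by rewrite natrD !fp_valK ?fp_trace_mem // fp_traceD.
Qed.

Lemma trace_char_eq1 (x : F) : (e x == 1) = (T x == 0).
Proof.
rewrite -(expr0 xi) (eq_prim_root_expr xi_prim) -eqr_nat_pchar.
by rewrite fp_valK ?fp_trace_mem.
Qed.

Lemma trace_char0 : e 0 = 1.
Proof. by apply/eqP; rewrite trace_char_eq1 fp_trace0. Qed.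

Lemma sum_trace_char_subfield (a : F) :
  \sum_(x in Fp) e (a * x) = p%:R *+ (T a == 0).
Proof.
have [Ta0|Ta] := eqVneq (T a) 0.
  rewrite (eq_bigr (fun=> 1)) => [|x /prime_subfieldP[k _ ->]].
    by rewrite sumr_const card_prime_subfield.
  by apply/eqP; rewrite trace_char_eq1 mulrC fp_trace_natr Ta0 mulr0.
apply: (@sum_nontrivial_eq0 _ _ _ _ 1).
- by move=> x y; rewrite mulrDr trace_charD.
- by move=> x; rewrite prime_subfieldD ?(mem_prime_subfield 1).
- by rewrite mulr1 trace_char_eq1.
Qed.

Lemma sum_trace_char (a : F) :
  \sum_x e (a * x) = (p ^ r)%:R *+ (a == 0).
Proof.
have [->|a_neq0] := eqVneq a 0.
  under eq_bigr do rewrite mul0r trace_char0.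
  by rewrite sumr_const cardF.
have [x Tx] := fp_trace_neq0.
apply: (@sum_nontrivial_eq0 _ _ predT _ (a^-1 * x)) => //.
  by move=> y z; rewrite mulrDr trace_charD.
by rewrite mulVKf // trace_char_eq1.
Qed.

Hypothesis r_gt0 : (0 < r)%N.

(** The indicator of the kernel of the trace is p^-1 times the sum of e (y x)
    over y in the prime subfield. Inserting it and exchanging the sums leaves
    the full character sums at a + y, of which only y = - a can survive; so the
    orthogonal of the kernel comes without any duality argument. *)
Lemma sum_trace_char_ker (a : F) :
  \sum_(x | T x == 0) e (a * x) = (p ^ r.-1)%:R *+ (a \in Fp).
Proof.
have pL0 : p%:R != 0 :> L by rewrite pnatr_eq0 -lt0n.
apply: (mulfI pL0); rewrite mulr_sumr.
have -> : \sum_(x | T x == 0) p%:R * e (a * x)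
    = \sum_x \sum_(y in Fp) e ((a + y) * x).
  rewrite big_mkcond; apply: eq_bigr => x _.
  under [RHS]eq_bigr => y _ do rewrite mulrDl trace_charD [y * x]mulrC.
  rewrite -mulr_sumr sum_trace_char_subfield mulrC.
  by case: eqP => // _; rewrite mulr0.
rewrite exchange_big; under eq_bigr do rewrite sum_trace_char.
rewrite mulrnAr -natrM -expnS prednK //.
have Fp_opp : (- a \in Fp) = (a \in Fp).
  have opp u : u \in Fp -> - u \in Fp.
    by move=> Fpu; rewrite -(prime_subfieldD _ Fpu) subrr prime_subfield0.
  by apply/idP/idP => /opp //; rewrite opprK.
rewrite -Fp_opp; have [Fpa|Fpa] := boolP (- a \in Fp).
  rewrite (bigD1 (- a)) //= subrr eqxx big1 ?addr0 // => y /andP[_ ne].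
  by rewrite addrC addr_eq0 (negPf ne).
rewrite big1 // => y Fpy; case: eqP => // /eqP.
by rewrite addrC addr_eq0 => /eqP ya; rewrite -ya Fpy in Fpa.
Qed.

Lemma fp_trace_subfield_eq0 (x : F) :
  x \in Fp -> (T x == 0) = (p %| r)%N || (x == 0).
Proof.
by move=> Fpx; rewrite fp_trace_subfield // mulf_eq0 -(dvdn_pcharf pcharF).
Qed.

(** The blocks as the fibres of one function, so that sums over vectors can be
    split according to the blocks of the coordinates. *)
Definition block_index (x : F) : 'I_4 :=
  if x == 0 then inord 0 else if x \in Fp then inord 1
  else if T x == 0 then inord 2 else inord 3.

Lemma mem_st_block (i : 'I_4) (x : F) :
  (x \in st_block p r F i) = (block_index x == i).
Proof.
rewrite /st_block /block_index -val_eqE.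
have [x0|x_neq0] := eqVneq x 0; last first.
  by case: i => -[|[|[|[|//]]]] lt_i; rewrite /= !inE -/Fp -/T ?(negPf x_neq0);
    case: (x \in Fp); rewrite ?inordK //; case: (T x == 0); rewrite inordK.
by case: i => -[|[|[|[|//]]]] lt_i;
  rewrite /= !inE inordK // x0 ?eqxx ?prime_subfield0 ?fp_trace0.
Qed.

(** The sum of e (a x) over x in block j, for a in block i; trace0 tells whether
    Tr a = 0. The prime subfield sums to 1 + s1 and the kernel of the trace to
    Q *+ (i <= 1). The latter is the union of 0, block 2 and, when p divides r,
    block 1. The last block is what remains of F. *)
Definition block_char_sum (p r : nat) (i j : 'I_4) : int :=
  let P := p%:Z in
  let Q := P ^+ r.-1 in
  let trace0 :=
    [|| i == 0%N :> nat, (i == 1%N :> nat) && (p %| r)%N | i == 2%N :> nat] in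
  let s1 := P *+ trace0 - 1 in
  let s2 := Q *+ (i <= 1)%N - 1 - s1 *+ (p %| r)%N in
  match nat_of_ord j with
  | 0 => 1
  | 1 => s1
  | 2 => s2
  | _ => (P * Q) *+ (i == 0%N :> nat) - 1 - s1 - s2
  end.

Lemma sum_trace_char_block (i j : 'I_4) (a : F) :
  a \in st_block p r F i ->
  \sum_(x in st_block p r F j) e (a * x) = (block_char_sum p r i j)%:~R.
Proof.
rewrite mem_st_block => /eqP def_i.
have a_eq0 : (a == 0) = (i == 0%N :> nat).
  rewrite -def_i /block_index; case: eqP => _; first by rewrite inordK.
  by case: (a \in Fp); [|case: (T a == 0)]; rewrite inordK.
have a_Fp : (a \in Fp) = (i <= 1)%N.
  rewrite -def_i /block_index; case: eqP => [->|_].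
    by rewrite inordK // prime_subfield0.
  by case: (a \in Fp); [|case: (T a == 0)]; rewrite inordK.
have a_trace : (T a == 0)
    = [|| i == 0%N :> nat, (i == 1%N :> nat) && (p %| r)%N | i == 2%N :> nat].
  rewrite -def_i /block_index; have [->|a_neq0] := eqVneq a 0.
    by rewrite inordK // fp_trace0 eqxx.
  case: ifP => [Fpa|_]; last by case: ifP => _; rewrite inordK.
  by rewrite inordK // fp_trace_subfield_eq0 // (negPf a_neq0) !orbF.
rewrite /block_char_sum -a_trace -a_eq0 -a_Fp.
cbv zeta; set s1 := _ *+ (T a == 0) - 1; set s2 := _ - s1 *+ _.
have pE : (p%:Z)%:~R = p%:R :> L by [].
have S_Fp : \sum_(x in Fp) e (a * x) = 1 + s1%:~R.
  by rewrite sum_trace_char_subfield /s1 rmorphB rmorphMn /= addrC subrK.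
have S2 : \sum_(x | (x \notin Fp) && (T x == 0)) e (a * x) = s2%:~R.
  have := sum_trace_char_ker a; rewrite (bigID (mem Fp)) /=.
  have -> : \sum_(x | (T x == 0) && (x \in Fp)) e (a * x)
      = 1 + s1%:~R *+ (p %| r)%N.
    case pr : (p %| r)%N.
      rewrite -S_Fp; apply: eq_bigl => x; case Fpx: (x \in Fp).
        by rewrite fp_trace_subfield_eq0 // pr.
      by rewrite andbF.
    rewrite (big_pred1 0) ?mulr0 ?trace_char0 ?addr0 // => x.
    case Fpx: (x \in Fp); first by rewrite fp_trace_subfield_eq0 // pr andbT.
    rewrite andbF; apply/esym; apply: contraFF Fpx => /eqP->.
    exact: prime_subfield0.
  under eq_bigl do rewrite andbC.
  move=> E; rewrite /s2 !rmorphB !rmorphMn /= rmorphXn /= -natrX -E.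
  by rewrite -addrA -opprD [1 + _ + _]addrC addrK.
case: j => [] [|[|[|[|//]]]] lt_j; rewrite /st_block /=.
- by rewrite big_set1 mulr0 trace_char0.
- move: S_Fp; rewrite (big_setD1 0) ?prime_subfield0 //= mulr0 trace_char0.
  by move/addrI.
- by rewrite -S2; apply: eq_bigl => x; rewrite inE.
have := sum_trace_char a; rewrite (bigID (mem Fp)) /= S_Fp.
rewrite (bigID (fun x => T x == 0)) /= S2 => E.
under eq_bigl do rewrite inE.
rewrite 3![in RHS]rmorphB rmorphMn rmorphM rmorphXn /= -natrX -natrM -expnS.
by rewrite prednK // -E -/Fp -/T; ring.
Qed.

End CharacterSums.

(** * The Krawtchouk coefficients as sums over block patterns *)

Section Krawtchouk.

Lemma sum_fibre_card_pairl (T I J : finType) (b : T -> I) (f : T -> J) (i : I) :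
  (\sum_j fibre_card (fun k => (b k, f k)) (i, j) = fibre_card b i)%N.
Proof.
rewrite {2}/fibre_card -sum1dep_card (partition_big f predT) //=.
by apply: eq_bigr => j _; rewrite sum1dep_card.
Qed.

Lemma sum_fibre_card_pairr (T I J : finType) (b : T -> I) (f : T -> J) (j : J) :
  (\sum_i fibre_card (fun k => (b k, f k)) (i, j) = fibre_card f j)%N.
Proof.
rewrite {2}/fibre_card -sum1dep_card (partition_big b predT) //=.
apply: eq_bigr => i _; rewrite sum1dep_card; apply: eq_card => k.
by rewrite !inE xpair_eqE andbC.
Qed.

Variables (p r n : nat).
Implicit Types (t : 'M['I_n.+1]_4) (pi rho : {ffun 'I_4 -> 'I_n.+1}).

Lemma prod_block_char_sum t :
  \prod_(x : 'I_4 * 'I_4) block_char_sum p r x.1 x.2 ^+ t x.1 x.2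
    = st_kappa p r t.
Proof.
have prod4 (F : 'I_4 -> int) :
    \prod_i F i = F (inord 0) * F (inord 1) * F (inord 2) * F (inord 3).
  rewrite !big_ord_recl big_ord0 mulr1 !mulrA.
  by congr (F _ * F _ * F _ * F _); apply: val_inj; rewrite /= inordK.
rewrite -(pair_bigA _ (fun i j => block_char_sum p r i j ^+ t i j)) /=.
rewrite prod4 !prod4 /block_char_sum !inordK //= /st_kappa /entry !expr1n.
move: (p%:Z) (p%:Z ^+ r.-1) => P Q.
case: (p %| r)%N; rewrite /= ?mulr1n ?mulr0n !exprD.
  have -> : Q - 1 - (P - 1) = Q - P by ring.
  have -> : P * Q - 1 - (P - 1) - (Q - P) = (P - 1) * Q by ring.
  have -> : 0 - 1 - (P - 1) - (Q - P) = - Q by ring.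
  have -> : 0 - 1 - (P - 1) = - P by ring.
  by rewrite !sub0r !subrr exprMn; ring.
have -> : P * Q - 1 - (P - 1) - (Q - 1 - 0) = (P - 1) * (Q - 1) by ring.
have -> : 0 - 1 - (0 - 1) - (Q - 1 - 0) = 1 - Q by ring.
have -> : 0 - 1 - (P - 1) - (0 - 1 - 0) = 1 - P by ring.
have -> : 0 - 1 - (0 - 1) - (0 - 1 - 0) = 1 :> int by ring.
by rewrite !subr0 !sub0r expr1n exprMn; ring.
Qed.

(** Group the patterns f by the table t of the joint fibre sizes of b and f: the
    product is st_kappa of the table, and card_colourings counts the patterns
    having this table. *)
Lemma st_kraw_patterns (b : 'I_n -> 'I_4) pi rho :
  (forall i, pi i = fibre_card b i :> nat) ->
  st_kraw p r pi rho
    = \sum_(f : {ffun 'I_n -> 'I_4} | [forall j, fibre_card f j == rho j])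
        \prod_k block_char_sum p r (b k) (f k).
Proof.
move=> def_pi; pose c f := fibre_card (fun k => (b k, f k) : 'I_4 * 'I_4).
pose tab (f : {ffun 'I_n -> 'I_4}) : 'M['I_n.+1]_4 :=
  \matrix_(i, j) inord (c f (i, j)).
have tabE f i j : tab f i j = c f (i, j) :> nat.
  rewrite mxE inordK // ltnS -[leqRHS]card_ord; exact: max_card.
rewrite (partition_big tab [in st_comp pi rho]) /=; last first.
  move=> f /forallP rho_f.
  rewrite inE; apply/andP; split; apply/forallP => i; apply/eqP.
    under eq_bigr do rewrite tabE.
    by rewrite def_pi sum_fibre_card_pairl.
  under eq_bigr do rewrite tabE.
  by rewrite sum_fibre_card_pairr; apply/eqP.
apply: eq_bigr => t; rewrite inE => /andP[/forallP row_t /forallP col_t].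
have tab_eq (f : {ffun 'I_n -> 'I_4}) :
    (tab f == t) = [forall x, c f x == t x.1 x.2].
  apply/eqP/forallP => [<- [i j]|eq_t]; first by rewrite tabE.
  apply/matrixP => i j; apply/val_inj; rewrite /= tabE.
  exact/eqP/(eq_t (i, j)).
transitivity (\sum_(f : {ffun 'I_n -> 'I_4}
  | [forall x, c f x == t x.1 x.2]) st_kappa p r t).
  rewrite sumr_const -mulr_natl; congr (_ * _); rewrite natz; congr Posz.
  have t_fact_gt0 : (0 < \prod_(x : 'I_4 * 'I_4) (t x.1 x.2)`!)%N.
    by rewrite prodn_gt0 // => x; rewrite fact_gt0.
  apply/eqP; rewrite -(eqn_pmul2r t_fact_gt0) -[in eqbRHS]cardsE.
  rewrite (@card_colourings _ _ _ b (fun x => t x.1 x.2)) => [|i]; last first.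
    by rewrite -def_pi; apply/eqP/row_t.
  rewrite -(pair_bigA _ (fun i j => (t i j)`!)) -big_split /=; apply/eqP.
  apply: eq_bigr => i _; rewrite -def_pi multinomial_fact //.
  exact/eqP/row_t.
(* A pattern with table t has fibres rho, as these are the column sums of t. *)
apply: eq_big => f; rewrite -tab_eq.
  case: eqP => [eq_t|_]; last by rewrite andbF.
  rewrite andbT; apply/esym/forallP => j; rewrite -(eqP (col_t j)) -eq_t.
  by under eq_bigr do rewrite tabE; rewrite sum_fibre_card_pairr.
move=> /eqP eq_t; rewrite -prod_block_char_sum -eq_t.
rewrite (prod_expr_fibre (fun k => (b k, f k))
  (fun x => block_char_sum p r x.1 x.2)).
by apply: eq_bigr => -[i j] _; rewrite tabE.
Qed.

End Krawtchouk.

(** * From character sums to the dual code *)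

Section MacWilliams.

Variables (p r n : nat) (F : finFieldType).
Hypotheses (p_prime : prime p) (r_gt0 : (0 < r)%N) (cardF : #|F| = (p ^ r)%N).
Variables (L : numClosedFieldType) (xi : L).
Hypothesis xi_prim : p.-primitive_root xi.

Let chi := st_char p r xi : 'rV[F]_n -> 'rV[F]_n -> L.
Let pattern (x : 'rV[F]_n) : {ffun 'I_n -> 'I_4} :=
  [ffun k => block_index p r (x 0 k)].

Lemma st_dec_pattern (x : 'rV[F]_n) (i : 'I_4) :
  st_dec p r x i = fibre_card (pattern x) i :> nat.
Proof.
rewrite ffunE; apply: eq_card => k.
by rewrite !inE ffunE (mem_st_block p_prime cardF).
Qed.

(** The character is a product over the coordinates, and the vectors with
    pattern f form a product of blocks. *)
Lemma sum_st_char_pattern (a : 'rV[F]_n) (f : {ffun 'I_n -> 'I_4}) :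
  \sum_(x | pattern x == f) chi a x
    = (\prod_k block_char_sum p r (pattern a k) (f k))%:~R.
Proof.
have chi_sum (x : 'rV[F]_n) :
    chi a x = \prod_k trace_char p r xi (a 0 k * x 0 k).
  rewrite -(big_morph _ (trace_charD p_prime cardF xi_prim)
    (trace_char0 p_prime cardF xi_prim)) //.
rewrite (eq_bigr _ (fun x _ => chi_sum x)).
rewrite (reindex (fun g : {ffun 'I_n -> F} => \row_k g k)); last first.
  exists (fun x : 'rV[F]_n => [ffun k => x 0 k]) => [g|x] _.
    by apply/ffunP => k; rewrite ffunE mxE.
  by apply/rowP => k; rewrite mxE ffunE.
rewrite rmorph_prod /=.
have block_sum k : (block_char_sum p r (pattern a k) (f k))%:~R
    = \sum_(y in st_block p r F (f k)) trace_char p r xi (a 0 k * y).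
  rewrite (sum_trace_char_block p_prime cardF xi_prim r_gt0
    (i := pattern a k)) //.
  by rewrite (mem_st_block p_prime cardF) ffunE.
rewrite [RHS](eq_bigr _ (fun k _ => block_sum k)).
rewrite (bigA_distr_big_dep (fun k => mem (st_block p r F (f k)))) /=.
apply: eq_big => [g|g _]; last by apply: eq_bigr => k _; rewrite mxE.
apply/eqP/familyP => [<- k|blocks_g].
  by rewrite /= (mem_st_block p_prime cardF) ffunE mxE.
apply/ffunP => k; rewrite ffunE mxE; apply/eqP.
by rewrite -(mem_st_block p_prime cardF); apply: blocks_g.
Qed.

Lemma sum_st_char_dec (a : 'rV[F]_n) (rho : {ffun 'I_4 -> 'I_n.+1}) :
  \sum_(x | st_dec p r x == rho) chi a x
    = (st_kraw p r (st_dec p r a) rho)%:~R.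
Proof.
have dec_eq x :
    (st_dec p r x == rho) = [forall j, fibre_card (pattern x) j == rho j].
  apply/eqP/forallP => [<- j|dec_x]; first by rewrite st_dec_pattern.
  by apply/ffunP => j; apply/val_inj; rewrite /= st_dec_pattern; apply/eqP.
rewrite (st_kraw_patterns p r rho (st_dec_pattern a)) rmorph_sum /=.
rewrite (partition_big pattern
  (fun f => [forall j, fibre_card f j == rho j])) /= => [|x]; last first.
  by rewrite dec_eq.
apply: eq_bigr => f rho_f; rewrite -sum_st_char_pattern.
apply: eq_bigl => x; rewrite dec_eq.
by case: eqP => [->|]; rewrite ?andbF ?rho_f.
Qed.

(** If x is not orthogonal to some c in C, a multiple of c by a scalar gives a
    codeword whose product with x has any prescribed value, in particular one
    of nonzero trace: the character is nontrivial on C. *)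
Lemma sum_code_st_char (C : {vspace 'rV[F]_n}) (x : 'rV[F]_n) :
  \sum_(c in C) chi c x = #|C|%:R *+ (x \in dual_code C).
Proof.
case x_dual: (x \in dual_code C); move: x_dual; rewrite inE.
  move=> /forall_inP x_dual; rewrite (eq_bigr (fun=> 1)) ?sumr_const // => c Cc.
  apply/eqP; rewrite [chi c x == 1](trace_char_eq1 p_prime cardF xi_prim).
  have -> : \sum_k c 0 k * x 0 k = 0.
    rewrite -[RHS](eqP (x_dual c Cc)).
    by apply: eq_bigr => k _; rewrite mulrC.
  by rewrite (fp_trace0 p_prime cardF).
case/negbT/forall_inPn => c Cc xc_neq0.
have [y Ty] := fp_trace_neq0 p_prime cardF.
set s := \sum_i _ in xc_neq0.
apply: (@sum_nontrivial_eq0 _ _ _ _ ((y / s) *: c)) => [u v|u|].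
- rewrite /chi /st_char -(trace_charD p_prime cardF xi_prim) -big_split /=.
  by under eq_bigr do rewrite mxE mulrDl.
- by rewrite rpredDl // memvZ.
rewrite [chi _ x == 1](trace_char_eq1 p_prime cardF xi_prim).
under eq_bigr do rewrite mxE -mulrA [c _ _ * _]mulrC.
by rewrite -mulr_sumr divfK.
Qed.

End MacWilliams.

Theorem corollary33 (p r n : nat) (p_prime : prime p) (r_ge1 : (1 <= r)%N)
    (n_ge1 : (1 <= n)%N) (F : finFieldType) (cardF : #|F| = (p ^ r)%N)
    (C : {vspace 'rV[F]_n})
    (L : numClosedFieldType) (xi : L) (xi_prim : p.-primitive_root xi) :
  (forall rho : {ffun 'I_4 -> 'I_n.+1}, rho \in st_decs p r F n ->
     (st_enum p r (dual_code C) rho)%:R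
       = (#|C|%:R)^-1
         * \sum_(pi in st_decs p r F n)
             (st_kraw p r pi rho)%:~R * (st_enum p r C pi)%:R :> L)
  /\
  (forall (pi rho : {ffun 'I_4 -> 'I_n.+1}) (a : 'rV[F]_n),
     pi \in st_decs p r F n -> rho \in st_decs p r F n ->
     st_dec p r a = pi ->
     \sum_(x : 'rV[F]_n | st_dec p r x == rho) st_char p r xi a x
       = (st_kraw p r pi rho)%:~R).
Proof.
split=> [rho _|pi rho a _ _ <-]; last exact: sum_st_char_dec.
have C_neq0 : #|C|%:R != 0 :> L.
  by rewrite pnatr_eq0 -lt0n; apply/card_gt0P; exists 0; apply: mem0v.
apply: (mulfI C_neq0); rewrite mulVKf //.
(* Both sides are the double sum of the character over the codewords c and the
   vectors x of decomposition rho. *)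
transitivity (\sum_(c in C) (st_kraw p r (st_dec p r c) rho)%:~R : L).
  under [RHS]eq_bigr do rewrite -(sum_st_char_dec p_prime r_ge1 cardF xi_prim).
  rewrite exchange_big /=.
  under eq_bigr do rewrite (sum_code_st_char p_prime cardF xi_prim).
  rewrite mulr_natr -sumr_const big_mkcond [RHS]big_mkcond /=.
  apply: eq_bigr => x _; rewrite [in LHS]inE andbC.
  by case: eqP => //=; case: ifP.
rewrite (partition_big (@st_dec p r F n) [in st_decs p r F n]) /=; last first.
  by move=> c _; apply: imset_f.
apply: eq_bigr => pi _; rewrite mulr_natr -sumr_const.
by apply: eq_big => [c|c /andP[_ /eqP->]]; rewrite ?inE.
Qed.
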